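(* Let $\boldsymbol{b} = (b_n)_{n \geq 0}$ and $\boldsymbol{\lambda} = (\lambda_n)_{n \geq 0}$ be sequences of positive integers, and let \[ \xi(\boldsymbol{b}, \boldsymbol{\lambda}) = [0, \overline{b_0}^{\lambda_0}, \overline{b_1}^{\lambda_1}, \overline{b_2}^{\lambda_2}, \ldots] \] be the real number whose continued fraction expansion has $0$ as integer part, followed by $\lambda_0$ partial quotients equal to $b_0$, then $\lambda_1$ partial quotients equal to $b_1$, and so on. Assume that \[ \lim_{n \to \infty} b_n = \lim_{n \to \infty} \lambda_n = \lim_{n \to \infty} \frac{\log b_{n+1}}{\sum_{k=0}^{n} \lambda_k \log b_k} = +\infty. \] Then $\xi(\boldsymbol{b}, \boldsymbol{\lambda})$ is a Liouville number, and \[ w_{=2}(\xi(\boldsymbol{b}, \boldsymbol{\lambda})) = w_{=2}^{*}(\xi(\boldsymbol{b}, \boldsymbol{\lambda})) = +\infty. \]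
   Context: For a polynomial $P \in \mathbb{Z}[X]$, $H(P)$ denotes the maximum of the absolute values of its coefficients. For a real algebraic number $\alpha$, $H(\alpha) = H(P)$, where $P$ is the minimal polynomial of $\alpha$ over $\mathbb{Z}$. Let $\xi$ be real and $n \geq 1$ an integer. $w_1(\xi)$ is the supremum of the real numbers $w$ such that, for arbitrarily large $H$, there is a polynomial $P \in \mathbb{Z}[X]$ of degree at most $1$ with $H(P) \leq H$ and $0 < |P(\xi)| \leq H^{-w}$. A real number $\xi$ is a Liouville number if $w_1(\xi) = +\infty$. $w_{=n}(\xi)$ is the supremum of the real numbers $w$ such that, for arbitrarily large $H$, there is an irreducible polynomial $P \in \mathbb{Z}[X]$ of degree exactly $n$ with $H(P) \leq H$ and $0 < |P(\xi)| \leq H^{-w}$. $w_{=n}^{*}(\xi)$ is the supremum of the real numbers $w^{*}$ such that, for arbitrarily large $H$, there is a real algebraic number $\alpha$ of degree exactly $n$ with $H(\alpha) \leq H$ and $0 < |\xi - \alpha| \leq H(\alpha)^{-1} H^{-w^{*}}$. The notation $\overline{a}^{\lambda}$ inside a continued fraction means that the letter $a$ is repeated $\lambda$ times. *)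

(* Defs.v *)
From HB Require Import structures.
From mathcomp Require Import all_boot all_order all_algebra.
From mathcomp Require Import all_classical all_reals all_analysis.
Set Implicit Arguments. Unset Strict Implicit. Unset Printing Implicit Defensive.
Import Order.TTheory GRing.Theory Num.Theory.
Import numFieldNormedType.Exports.
Local Open Scope classical_set_scope.
Local Open Scope ring_scope.

Definition height (P : {poly int}) : nat := \max_(i < size P) absz (P`_i)%R.

Definition zeval (R : realType) (P : {poly int}) (x : R) : R :=
  (map_poly (fun z : int => z%:~R) P).[x].

Definition zirreducible (P : {poly int}) : Prop :=
  P != 0 /\ P \isn't a GRing.unit /\
  forall Q S : {poly int}, P = Q * S -> Q \is a GRing.unit \/ S \is a GRing.unit.

Definition zminpoly (R : realType) (alpha : R) (P : {poly int}) : Prop :=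
  zirreducible P /\ 0 < lead_coef P /\ zeval P alpha = 0.

Definition w1_good (R : realType) (xi : R) (w : R) : Prop :=
  forall H0 : R, exists H : R, H0 <= H /\
    exists P : {poly int}, (size P <= 2)%N /\ (height P)%:R <= H /\
      0 < `|zeval P xi| /\ `|zeval P xi| <= H `^ (- w).

Definition Liouville (R : realType) (xi : R) : Prop :=
  forall M : R, exists w : R, M <= w /\ w1_good xi w.

Definition weq_good (R : realType) (n : nat) (xi : R) (w : R) : Prop :=
  forall H0 : R, exists H : R, H0 <= H /\
    exists P : {poly int}, zirreducible P /\ size P = n.+1 /\ (height P)%:R <= H /\
      0 < `|zeval P xi| /\ `|zeval P xi| <= H `^ (- w).

Definition weq_infinite (R : realType) (n : nat) (xi : R) : Prop :=
  forall M : R, exists w : R, M <= w /\ weq_good n xi w.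

(* set of w* in the definition of w*_{=n}; H(alpha) = height of the minimal
   polynomial P of alpha over Z, degree of alpha = degree of P. *)
Definition weqstar_good (R : realType) (n : nat) (xi : R) (w : R) : Prop :=
  forall H0 : R, exists H : R, H0 <= H /\
    exists (alpha : R) (P : {poly int}), zminpoly alpha P /\ size P = n.+1 /\
      (height P)%:R <= H /\
      0 < `|xi - alpha| /\ `|xi - alpha| <= ((height P)%:R)^-1 * H `^ (- w).

Definition weqstar_infinite (R : realType) (n : nat) (xi : R) : Prop :=
  forall M : R, exists w : R, M <= w /\ weqstar_good n xi w.

Fixpoint cf_aux (R : realType) (a : nat -> nat) (n i : nat) : R :=
  match n with
  | 0 => 0
  | m.+1 => ((a i)%:R + cf_aux R a m i.+1)^-1
  end.

Definition cf_fin (R : realType) (a : nat -> nat) (n : nat) : R := cf_aux R a n 0.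

Definition cf_value (R : realType) (a : nat -> nat) (xi : R) : Prop :=
  cf_fin R a @ \oo --> xi.

Definition block_digits (b lam a : nat -> nat) : Prop :=
  forall n i : nat, (i < lam n)%N -> a ((\sum_(j < n) lam j) + i)%N = b n.

(* Main.v *)
(* Let N be the start of the n-th block of digits, B = b_n its digit, and p'/q',
   p/q the last two convergents before the block. The growth hypothesis makes B
   larger than any fixed power of q, since q <= (prod_{k<n} b_k^lam_k)^C with C
   independent of n. The polynomial q X - p then gives w_1 = +oo. For degree 2,
   let alpha have the same digits as xi before the block and then only B's; with
   z = [0, B, B, ...], the positive root of t^2 + B t - 1, we have
   alpha = (p + p' z) / (q + q' z), so alpha is a root of
     P = (q' X - p')^2 + B (q X - p) (q' X - p') - (q X - p)^2,
   whose height is at most B^3. P is primitive because as a binary form it takes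
   the value 1 at (p, q), and has no rational root because its discriminant
   B^2 + 4 is not a square. Finally alpha and xi share their first N + lam_n
   digits, so |xi - alpha| <= B^(-2 lam_n), and lam_n tends to infinity. *)
Require Import Defs.
From HB Require Import structures.
From mathcomp Require Import all_boot all_order all_algebra.
From mathcomp Require Import all_classical all_reals all_analysis.
From mathcomp Require Import ring lra zify.
Import Order.TTheory GRing.Theory Num.Theory.
Import numFieldNormedType.Exports.
Local Open Scope classical_set_scope.
Local Open Scope ring_scope.

(** * Convergents *)

Fixpoint continuant (c0 c1 : nat) (a : nat -> nat) (m : nat) : nat :=
  match m with
  | 0 => c0
  | m'.+1 => match m' with
             | 0 => c1
             | k.+1 => (a k * continuant c0 c1 a m' + continuant c0 c1 a k)%N
             end
  end.

(* Indices are shifted by one: the [m]-th convergent is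
   [cfnum a m.+1 / cfden a m.+1], and index [0] plays the role of [-1]. *)
Definition cfnum := continuant 1 0.
Definition cfden := continuant 0 1.

Lemma cfnumSS a m : cfnum a m.+2 = (a m * cfnum a m.+1 + cfnum a m)%N.
Proof. by []. Qed.

Lemma cfdenSS a m : cfden a m.+2 = (a m * cfden a m.+1 + cfden a m)%N.
Proof. by []. Qed.

Lemma cf_det (K : comNzRingType) a m :
  (cfnum a m.+1)%:R * (cfden a m)%:R - (cfnum a m)%:R * (cfden a m.+1)%:R
  = (-1) ^+ m.+1 :> K.
Proof.
elim: m => [|m IH]; first by rewrite /cfnum /cfden /=; ring.
rewrite cfnumSS cfdenSS !natrD !natrM exprS -IH; ring.
Qed.

Section positive_digits.
Variable a : nat -> nat.
Hypothesis a_gt0 : forall i, (0 < a i)%N.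

Lemma cfden_gt0 m : (0 < cfden a m.+1)%N.
Proof.
by elim: m => [|m IH] //; rewrite cfdenSS ltn_addr // muln_gt0 a_gt0.
Qed.

Lemma cfden_leS m : (cfden a m <= cfden a m.+1)%N.
Proof.
case: m => [|m] //; rewrite cfdenSS.
by apply: leq_trans (leq_addr _ _); apply: leq_pmull.
Qed.

(** The integer part is 0, so every convergent lies in [0, 1]. The shifted index matters, since the
    pair at index [0] is (1, 0); the two-term recursion forces an induction on two consecutive
    inequalities. *)
Lemma cfnum_le_cfden m : (cfnum a m.+1 <= cfden a m.+1)%N.
Proof.
suff: (cfnum a m.+1 <= cfden a m.+1)%N && (cfnum a m.+2 <= cfden a m.+2)%N.
  by case/andP.
elim: m => [|m /andP[IH1 IH2]].
  by rewrite /cfnum /cfden /= muln0 muln1 addn0 a_gt0.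
by rewrite IH2 cfnumSS cfdenSS leq_add // leq_mul2l IH2 orbT.
Qed.

(** Since denominators do not decrease, one digit [B] multiplies them by a factor between [B] and
    [B + 1]. *)
Lemma cfden_block (B N l : nat) :
  (forall i, (i < l)%N -> a (N + i)%N = B) ->
  (B ^ l * cfden a N.+1 <= cfden a (N + l).+1 <= B.+1 ^ l * cfden a N.+1)%N.
Proof.
elim: l => [|l IH] aB; first by rewrite !expn0 !mul1n addn0 !leqnn.
have /andP[lo up] := IH (fun i il => aB i (ltnW il)).
rewrite addnS cfdenSS aB // !expnS -!mulnA; apply/andP; split.
  by apply: leq_trans (leq_addr _ _); rewrite leq_mul2l lo orbT.
apply: (@leq_trans (B.+1 * cfden a (N + l).+1)).
  by rewrite mulSn addnC leq_add2r cfden_leS.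
by rewrite leq_mul2l up orbT.
Qed.

Section real_field.
Variable R : realType.
Local Notation p m := ((cfnum a m)%:R : R).
Local Notation q m := ((cfden a m)%:R : R).

(* [cf_moebius m t] is the continued fraction with digits [a 0, ..., a m.-1]
   followed by the tail [t]. *)
Definition cf_moebius m (t : R) := (p m.+1 + p m * t) / (q m.+1 + q m * t).

Lemma cf_moebius_den_ge m (t : R) : 0 <= t -> q m.+1 <= q m.+1 + q m * t.
Proof. by move=> t0; rewrite lerDl mulr_ge0. Qed.

Lemma cf_moebius_den_gt0 m (t : R) : 0 <= t -> 0 < q m.+1 + q m * t.
Proof.
by move=> t0; apply: lt_le_trans (cf_moebius_den_ge _ _ t0); rewrite ?ltr0n ?cfden_gt0.
Qed.

Lemma cf_moebius0 t : cf_moebius 0 t = t.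
Proof. by rewrite /cf_moebius /cfnum /cfden /= add0r mul1r mul0r addr0 divr1. Qed.

Lemma cf_moebiusS m t : 0 <= t ->
  cf_moebius m.+1 t = cf_moebius m ((a m)%:R + t)^-1.
Proof.
move=> t0; have s0 : 0 < (a m)%:R + t by rewrite ltr_wpDr // ltr0n.
have shift (u v : R) : (a m)%:R * u + v + u * t
    = (u + v * ((a m)%:R + t)^-1) * ((a m)%:R + t).
  by field; exact: lt0r_neq0.
rewrite /cf_moebius cfnumSS cfdenSS !natrD !natrM !shift.
by rewrite -mulf_div divff ?mulr1 ?lt0r_neq0.
Qed.

Lemma cf_moebius_tail (y : nat -> R) :
  (forall i, 0 <= y i) -> (forall i, y i = ((a i)%:R + y i.+1)^-1) ->
  forall m, y 0 = cf_moebius m (y m).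
Proof.
move=> y0 yE; elim=> [|m IH]; first by rewrite cf_moebius0.
by rewrite cf_moebiusS // -yE.
Qed.

(** The tail [z] is a fixed point of prepending the digit [B]. Hence alpha, built from [N] digits,
    can also be read at depth [N + l], where it still agrees with xi. *)
Lemma cf_moebius_fixed (B N l : nat) (z : R) :
  0 <= z -> z = (B%:R + z)^-1 -> (forall i, (i < l)%N -> a (N + i)%N = B) ->
  cf_moebius (N + l) z = cf_moebius N z.
Proof.
move=> z0 zE; elim: l => [|l IH] aB; first by rewrite addn0.
by rewrite addnS cf_moebiusS // aB // -zE IH // => i il; rewrite aB // ltnW.
Qed.

Lemma cf_moebiusB m s t : 0 <= s -> 0 <= t ->
  cf_moebius m s - cf_moebius m t
  = (-1) ^+ m * (s - t) / ((q m.+1 + q m * s) * (q m.+1 + q m * t)).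
Proof.
move=> s0 t0; have ds := cf_moebius_den_gt0 m _ s0.
have dt := cf_moebius_den_gt0 m _ t0.
have := cf_det R a m; rewrite exprS mulN1r => /(congr1 -%R); rewrite opprK => <-.
by rewrite /cf_moebius; field; rewrite !lt0r_neq0.
Qed.

Lemma cf_moebius_dist m s t : 0 <= s <= 1 -> 0 <= t <= 1 ->
  `|cf_moebius m s - cf_moebius m t| <= (q m.+1 ^+ 2)^-1.
Proof.
move=> /andP[s0 s1] /andP[t0 t1]; rewrite cf_moebiusB //.
have ds := cf_moebius_den_gt0 m _ s0; have dt := cf_moebius_den_gt0 m _ t0.
have q0 : 0 < q m.+1 by rewrite ltr0n cfden_gt0.
rewrite !normrM normrX normrN1 expr1n mul1r normfV.
rewrite [X in _ / X]gtr0_norm ?mulr_gt0 // -[leRHS]mul1r ler_pM //.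
- by rewrite invr_ge0 ltW // mulr_gt0.
- by rewrite ler_norml; apply/andP; split; lra.
- rewrite lef_pV2 ?posrE ?mulr_gt0 ?exprn_gt0 // expr2.
  by rewrite ler_pM ?cf_moebius_den_ge // ltW.
Qed.

End real_field.
End positive_digits.

(** * Complete quotients *)

Section tails.
Variables (R : realType) (a : nat -> nat) (xi : R).
Hypothesis a_gt0 : forall i, (0 < a i)%N.

Lemma digit_add_gt0 i (t : R) : 0 <= t -> 0 < (a i)%:R + t.
Proof. by move=> t0; rewrite ltr_wpDr // ltr0n. Qed.

Lemma cf_aux_ge0 n i : 0 <= cf_aux R a n i.
Proof. by elim: n i => [|n IH] i //=; rewrite invr_ge0 addr_ge0. Qed.

(** The bounds do not depend on [n], so they pass to the limit; the positive lower one keeps limits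
    of tails away from 0, where inversion is not continuous. *)
Lemma cf_auxS_bounds n i :
  (((a i)%:R + 1)^-1 : R) <= cf_aux R a n.+1 i <= 1.
Proof.
have a1 j : (1 : R) <= (a j)%:R by rewrite ler1n.
have le1 k j : cf_aux R a k j <= 1.
  case: k => [|k] //=; rewrite invf_le1; last exact/digit_add_gt0/cf_aux_ge0.
  by have := cf_aux_ge0 k j.+1; have := a1 j; lra.
rewrite le1 andbT /= lef_pV2 ?posrE ?lerD2l ?le1 //.
exact/digit_add_gt0/cf_aux_ge0.
Qed.

Lemma cf_tails : cf_value a xi -> exists y : nat -> R,
  [/\ y 0 = xi, forall i, 0 < y i <= 1
    & forall i, y i = ((a i)%:R + y i.+1)^-1].
Proof.
move=> cv.
(* Solve the wanted relation for [y i.+1]. Convergence then moves from tail [i] to tail [i.+1] by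
   the same formula applied to finite truncations. *)
pose y := fix y i := if i is j.+1 then (y j)^-1 - (a j)%:R else xi.
have bnd i (l : R) : (cf_aux R a)^~ i @ \oo --> l -> 0 < l <= 1.
  move=> cl; have cl' : (fun n => cf_aux R a n.+1 i) @ \oo --> l.
    by rewrite (cvg_shiftS (cf_aux R a ^~ i)).
  apply/andP; split.
    have : 0 < ((a i)%:R + 1)^-1 :> R by rewrite invr_gt0 digit_add_gt0.
    move/lt_le_trans; apply; apply: (cvgr_to_ge cl'); near=> n.
    by have /andP[] := cf_auxS_bounds n i.
  apply: (cvgr_to_le cl'); near=> n.
  by have /andP[] := cf_auxS_bounds n i.
have cy i : (cf_aux R a)^~ i @ \oo --> y i.
  elim: i => [|i IH]; first exact: cv.
  have /andP[yi0 _] := bnd _ _ IH.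
  have cl' : (fun n => cf_aux R a n.+1 i) @ \oo --> y i.
    by rewrite (cvg_shiftS (cf_aux R a ^~ i)).
  have -> : (cf_aux R a)^~ i.+1 = (fun n => (cf_aux R a n.+1 i)^-1 - (a i)%:R).
    by apply/funext => n /=; rewrite invrK addrC addKr.
  apply: cvgB; last exact: cvg_cst.
  by apply: cvgV => //; rewrite gt_eqF.
exists y; split => // i; first exact: bnd (cy i).
by rewrite /= addrC subrK invrK.
Unshelve. all: by end_near. Qed.

End tails.

(** * Integral quadratic polynomials *)

Definition zquadratic (A C D : int) : {poly int} := Poly [:: D; C; A].

Lemma size_zquadratic (A C D : int) : A != 0 -> size (zquadratic A C D) = 3%N.
Proof. by move=> A0; rewrite (@PolyK _ 1). Qed.

Lemma lead_coef_zquadratic (A C D : int) :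
  A != 0 -> lead_coef (zquadratic A C D) = A.
Proof. by move=> A0; rewrite /lead_coef size_zquadratic // coef_Poly. Qed.

Lemma zeval_zquadratic (R : realType) (A C D : int) (x : R) :
  zeval (zquadratic A C D) x = A%:~R * x ^+ 2 + C%:~R * x + D%:~R.
Proof.
rewrite /zeval /zquadratic /= !cons_poly_def mul0r add0r !rmorphD !rmorphM /=.
rewrite !rmorphD !rmorphM /= !map_polyX !map_polyC !hornerE /=.
ring.
Qed.

Lemma height_zquadratic_le (A C D : int) (h : nat) :
  (`|A| <= h)%N -> (`|C| <= h)%N -> (`|D| <= h)%N ->
  (height (zquadratic A C D) <= h)%N.
Proof.
move=> hA hC hD; apply/bigmax_leqP => i _; rewrite coef_Poly.
by case: (val i) => [|[|[|[|k]]]].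
Qed.

Lemma height_gt0 (P : {poly int}) : P != 0 -> (0 < height P)%N.
Proof.
move=> P0; have sP : (0 < size P)%N by rewrite size_poly_gt0.
have lt : ((size P).-1 < size P)%N by rewrite prednK.
apply: leq_trans (@leq_bigmax _ (fun i : 'I_(size P) => absz P`_i) (Ordinal lt)).
by rewrite absz_gt0 /= -lead_coefE lead_coef_eq0.
Qed.

(** A proper factorisation has either a constant factor, which must divide the value 1 of the form,
    or two linear factors, which would make the discriminant a square. *)
Lemma zirreducible_zquadratic (A C D x y : int) : A != 0 ->
  A * x ^+ 2 + C * (x * y) + D * y ^+ 2 = 1 ->
  (forall k, C ^+ 2 - 4 * A * D != k ^+ 2) ->
  zirreducible (zquadratic A C D).
Proof.
move=> A0 form1 disc; have sP := size_zquadratic A C D A0.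
have P0 : zquadratic A C D != 0 by rewrite -size_poly_eq0 sP.
split=> //; split; first by rewrite poly_unitE sP.
(* A constant factor divides the value 1 of the form. *)
have const (Q S : {poly int}) : zquadratic A C D = Q * S -> size Q = 1%N ->
    Q \is a GRing.unit.
  move=> PE /eqP/size_poly1P[c c0 QE].
  rewrite QE poly_unitE size_polyC c0 coefC /=.
  have coefE i : (zquadratic A C D)`_i = c * S`_i by rewrite PE QE coefCM.
  have := coefE 0%N; have := coefE 1%N; have := coefE 2%N.
  rewrite !coef_Poly /= => AE CE DE.
  (* The form of the cofactor [S], evaluated at ([x], [y]), is the inverse of [c]. *)
  apply/unitrP; exists (S`_2 * x ^+ 2 + S`_1 * (x * y) + S`_0 * y ^+ 2).
  by split; rewrite -form1 AE CE DE; ring.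
move=> Q S PE.
have [Q0 S0] : Q != 0 /\ S != 0.
  by apply/andP; rewrite -negb_or -mulf_eq0 -PE.
have := size_mul Q0 S0; rewrite -PE sP.
have sQ : (0 < size Q)%N by rewrite size_poly_gt0.
have sS : (0 < size S)%N by rewrite size_poly_gt0.
have [Q1|Q1] := eqVneq (size Q) 1%N; first by left; apply: (const Q S).
have [S1|S1] := eqVneq (size S) 1%N.
  by right; apply: (const S Q) => //; rewrite mulrC.
move=> sz; exfalso.
have [Q2 S2] : size Q = 2%N /\ size S = 2%N.
  by move: Q1 S1 sQ sS sz; case: (size Q) => [|[|[|u]]] //;
    case: (size S) => [|[|[|v]]]; lia.
have lin (T : {poly int}) : size T = 2%N -> T = T`_1 *: 'X + (T`_0)%:P.
  move=> T2; apply/polyP => i; rewrite coefD coefZ coefX coefC.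
  case: i => [|[|i]] /=; rewrite ?mulr0 ?mulr1 ?addr0 ?add0r //.
  by rewrite nth_default // T2.
(* The discriminant of a product of two linear polynomials is the square of their resultant. *)
have := disc (Q`_1 * S`_0 - Q`_0 * S`_1).
have /polyP PE' : zquadratic A C D = zquadratic (Q`_1 * S`_1)
   (Q`_1 * S`_0 + Q`_0 * S`_1) (Q`_0 * S`_0).
  rewrite PE (lin Q Q2) (lin S S2) /zquadratic /= !cons_poly_def mul0r add0r.
  rewrite !coefD !coefZ !coefX !coefC /= !(mulr0, mulr1, addr0, add0r).
  rewrite -!mul_polyC !polyCD !polyCM; ring.
have := PE' 0%N; have := PE' 1%N; have := PE' 2%N.
rewrite !coef_Poly /= => -> -> -> /eqP; apply; ring.
Qed.

(** B^2 + 4 lies strictly between B^2 and (B + 1)^2 as soon as 2 B + 1 > 4. *)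
Lemma addn4_nonsquare (B : nat) (k : int) : (2 <= B)%N ->
  (B%:R ^+ 2 + 4 : int) != k ^+ 2.
Proof.
move=> B2; apply/eqP => E.
have : (B ^ 2 + 4 = `|k| ^ 2)%N by lia.
have [|] := leqP `|k|%N B; nia.
Qed.

(** * Quadratic and linear approximations *)

(** This is 1 - B t - t^2 pulled back along t = (p - q X) / (q' X - p'), the inverse of
    [cf_moebius], with denominators cleared. *)
Definition cf_quadratic (a : nat -> nat) (N B : nat) : {poly int} :=
  let p := cfnum a N.+1 : int in let p' := cfnum a N : int in
  let q := cfden a N.+1 : int in let q' := cfden a N : int in
  zquadratic (q' ^+ 2 + B%:Z * q * q' - q ^+ 2)
    (2 * p * q - 2 * p' * q' - B%:Z * (p * q' + p' * q))
    (p' ^+ 2 + B%:Z * p * p' - p ^+ 2).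

Lemma cf_det_sqr (K : comNzRingType) a m :
  ((cfnum a m.+1)%:R * (cfden a m)%:R - (cfnum a m)%:R * (cfden a m.+1)%:R) ^+ 2
  = 1 :> K.
Proof. by rewrite cf_det sqrr_sign. Qed.

Lemma zirreducible_cf_quadratic a N B : (2 <= B)%N ->
  (cfden a N : int) ^+ 2 + B%:Z * cfden a N.+1 * cfden a N
     - (cfden a N.+1 : int) ^+ 2 != 0 ->
  zirreducible (cf_quadratic a N B).
Proof.
move=> B2 A0; have := cf_det_sqr int a N; rewrite !natz => det.
(* At (p, q) the linear form q x - p y vanishes, and only the squared determinant, which is 1,
   remains. The discriminant is B^2 + 4 times the same square. *)
apply: (@zirreducible_zquadratic _ _ _ (cfnum a N.+1) (cfden a N.+1)) => //.
  rewrite -[RHS]det; ring.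
move=> k; have := addn4_nonsquare B k B2; rewrite natz.
by rewrite -[_ + 4]mulr1 -[X in _ * X]det; congr (_ != _); ring.
Qed.

Section block.
Variable a : nat -> nat.
Hypothesis a_gt0 : forall i, (0 < a i)%N.
Variables (N B : nat).
Hypothesis N_gt0 : (0 < N)%N.
Hypothesis B_ge4 : (4 <= B)%N.
Hypothesis sqr_cfden_le : (cfden a N.+1 ^ 2 <= B)%N.

Let cfden_prev_gt0 : (0 < cfden a N)%N.
Proof. by rewrite -(prednK N_gt0) cfden_gt0. Qed.

Lemma lead_cf_quadratic_gt0 :
  0 < (cfden a N : int) ^+ 2 + B%:Z * cfden a N.+1 * cfden a N
     - (cfden a N.+1 : int) ^+ 2.
Proof.
have q0 := cfden_gt0 a a_gt0 N; have q'0 := cfden_prev_gt0.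
have : (cfden a N.+1 ^ 2 <= B * (cfden a N.+1 * cfden a N))%N.
  by apply: leq_trans sqr_cfden_le _; rewrite leq_pmulr // muln_gt0 q0.
have : (0 < cfden a N ^ 2)%N by rewrite expn_gt0 q'0.
lia.
Qed.

(** Products of two of p, p', q, q' are at most q^2 <= B, so each coefficient is at most 4 B^2,
    hence at most B^3 because B >= 4. *)
Lemma height_cf_quadratic_le : (height (cf_quadratic a N B) <= B ^ 3)%N.
Proof.
set q := cfden a N.+1; set q' := cfden a N.
set p := cfnum a N.+1; set p' := cfnum a N.
have q'q : (q' <= q)%N by exact: cfden_leS.
have pq : (p <= q)%N by exact: cfnum_le_cfden.
have p'q : (p' <= q)%N.
  by apply: leq_trans q'q; rewrite /p' /q' -(prednK N_gt0) cfnum_le_cfden.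
have prod u v : (u <= q)%N -> (v <= q)%N -> (u * v <= B)%N.
  by move=> uq vq; apply: leq_trans sqr_cfden_le; rewrite expnS expn1 leq_mul.
have prodB u v : (u <= q)%N -> (v <= q)%N -> (B * (u * v) <= B * B)%N.
  by move=> uq vq; rewrite leq_mul2l prod ?orbT.
have B3 : (4 * (B * B) <= B ^ 3)%N by rewrite !expnS expn0 muln1 leq_mul2r B_ge4 orbT.
have BB : (4 * B <= B * B)%N by rewrite leq_mul2r B_ge4 orbT.
apply: height_zquadratic_le.
- have := prod _ _ q'q q'q; have := prod _ _ (leqnn q) (leqnn q).
  have := prodB _ _ (leqnn q) q'q; rewrite -/q -/q' -/p -/p'; nia.
- have := prod _ _ pq (leqnn q); have := prod _ _ p'q q'q.
  have := prodB _ _ pq q'q; have := prodB _ _ p'q (leqnn q).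
  rewrite -/q -/q' -/p -/p'; nia.
- have := prod _ _ pq pq; have := prod _ _ p'q p'q.
  have := prodB _ _ pq p'q; rewrite -/q -/q' -/p -/p'; nia.
Qed.

Section real_values.
Variable R : realType.
Local Notation p := ((cfnum a N.+1)%:R : R).
Local Notation p' := ((cfnum a N)%:R : R).
Local Notation q := ((cfden a N.+1)%:R : R).
Local Notation q' := ((cfden a N)%:R : R).

Lemma zeval_cf_quadratic (x : R) : zeval (cf_quadratic a N B) x =
  (q' * x - p') ^+ 2 + B%:R * (q * x - p) * (q' * x - p') - (q * x - p) ^+ 2.
Proof. by rewrite zeval_zquadratic -!natz; ring. Qed.

(** With d = p q' - p' q, the forms q' x - p' and q x - p take the values d / (q + q' t) and - d t /
    (q + q' t), and d^2 = 1. *)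
Lemma zeval_cf_moebius (t : R) : 0 <= t ->
  zeval (cf_quadratic a N B) (cf_moebius a R N t)
  = (1 - B%:R * t - t ^+ 2) / (q + q' * t) ^+ 2.
Proof.
move=> t0; have d0 := lt0r_neq0 (cf_moebius_den_gt0 a a_gt0 R N t t0).
have det := cf_det_sqr R a N; rewrite -[RHS]mul1r -[X in _ = X * _]det.
by rewrite zeval_cf_quadratic /cf_moebius; field.
Qed.


Lemma periodic_tail :
  exists z : R, [/\ 0 < z <= 1, z ^+ 2 + B%:R * z = 1 & z = (B%:R + z)^-1].
Proof.
have B4 : (4 : R) <= B%:R by rewrite ler_nat.
set s := Num.sqrt (B%:R ^+ 2 + 4 : R).
have s2 : s ^+ 2 = B%:R ^+ 2 + 4 by rewrite sqr_sqrtr // addr_ge0 // sqr_ge0.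
have s0 : 0 <= s by exact: sqrtr_ge0.
have z0 : 0 < (s - B%:R) / 2 by nra.
have zE : ((s - B%:R) / 2) ^+ 2 + B%:R * ((s - B%:R) / 2) = 1.
  by rewrite [RHS](_ : _ = (s ^+ 2 - B%:R ^+ 2) / 4); [field | rewrite s2; field].
exists ((s - B%:R) / 2); split => //.
  by rewrite z0; nra.
have d0 : 0 < B%:R + (s - B%:R) / 2 by rewrite ltr_wpDl.
apply: (mulIf (lt0r_neq0 d0)); rewrite mulVf ?lt0r_neq0 // -[RHS]zE; ring.
Qed.

(** This separates xi from alpha. Equal tails at [N] stay equal through the block, but the next
    digit exceeds [B], so there 1 / y > B + 1 >= B + z = 1 / z. *)
Lemma tails_neq_periodic (y : nat -> R) (l : nat) (z : R) :
  (forall i, 0 < y i) -> (forall i, y i = ((a i)%:R + y i.+1)^-1) ->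
  (forall i, (i < l)%N -> a (N + i)%N = B) -> (B < a (N + l)%N)%N ->
  0 < z <= 1 -> z = (B%:R + z)^-1 -> y N != z.
Proof.
move=> y0 yE aB Bl /andP[z0 z1] zE; apply/eqP => yz.
suff : y (N + l)%N = z.
  have B1 : B%:R + 1 <= (a (N + l)%N)%:R :> R by rewrite natr1 ler_nat.
  rewrite yE zE => /invr_inj; have := y0 (N + l).+1; lra.
elim: l aB {Bl} => [|l IH] aB; first by rewrite addn0.
have IH' := IH (fun i il => aB i (ltnW il)).
move: (yE (N + l)%N); rewrite IH' aB // [LHS]zE => /invr_inj /addrI.
by rewrite addnS.
Qed.

Lemma quadratic_approximation (y : nat -> R) (l : nat) :
  (forall i, 0 < y i <= 1) -> (forall i, y i = ((a i)%:R + y i.+1)^-1) ->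
  (forall i, (i < l)%N -> a (N + i)%N = B) -> (B < a (N + l)%N)%N ->
  exists (alpha : R) (P : {poly int}),
    [/\ zminpoly alpha P /\ size P = 3%N, (0 < height P <= B ^ 3)%N,
       0 < `|y 0 - alpha| <= (B%:R ^+ (2 * l))^-1,
       0 < `|zeval P (y 0)| & `|zeval P (y 0)| <= B%:R ^+ 2 * `|y 0 - alpha|].
Proof.
move=> y01 yE aB Bl.
have ygt0 i : 0 < y i by case/andP: (y01 i).
have yge0 i : 0 <= y i by exact: ltW.
have [z [z01 z2 zE]] := periodic_tail.
have /andP[z0 z1] := z01; have zge0 := ltW z0.
have yz := tails_neq_periodic y l z ygt0 yE aB Bl z01 zE.
have y0E := cf_moebius_tail a a_gt0 R y yge0 yE.
have A0 := lead_cf_quadratic_gt0; have A_neq0 := lt0r_neq0 A0.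
have B2 : (2 <= B)%N by lia.
have irr := zirreducible_cf_quadratic a N B B2 A_neq0.
have dy := cf_moebius_den_gt0 a a_gt0 R N (y N) (yge0 N).
have dz := cf_moebius_den_gt0 a a_gt0 R N z zge0.
have diffE : `|y 0 - cf_moebius a R N z| =
    `|y N - z| / ((q + q' * y N) * (q + q' * z)).
  rewrite (y0E N) cf_moebiusB // !normrM normrX normrN1 expr1n mul1r normfV.
  by rewrite [X in _ / X]gtr0_norm // mulr_gt0.
have diff0 : 0 < `|y 0 - cf_moebius a R N z|.
  by rewrite diffE divr_gt0 ?mulr_gt0 // normr_gt0 subr_eq0.
(* As z^2 + B z = 1, the numerator factors as - (t - z) (t + z + B) at t = [y N]; comparison with
   [diffE] gives the exact ratio of |P(xi)| to |xi - alpha|. *)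
have evalE : `|zeval (cf_quadratic a N B) (y 0)| = `|y 0 - cf_moebius a R N z|
    * ((q + q' * z) / (q + q' * y N) * (y N + z + B%:R)).
  rewrite diffE (y0E N) zeval_cf_moebius //.
  have -> : 1 - B%:R * y N - y N ^+ 2 = - ((y N - z) * (y N + z + B%:R)).
    move: z2; nra.
  rewrite normrM normrN normrM normfV.
  rewrite (ger0_norm (_ : 0 <= y N + z + B%:R)) ?addr_ge0 //.
  rewrite (ger0_norm (exprn_ge0 2 (ltW dy))).
  by field; rewrite !lt0r_neq0.
have q0 : 0 < q by rewrite ltr0n cfden_gt0.
have q'q : q' <= q by rewrite ler_nat cfden_leS.
have qdy := cf_moebius_den_ge a R N (y N) (yge0 N).
have B4 : (4 : R) <= B%:R by rewrite ler_nat.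
exists (cf_moebius a R N z), (cf_quadratic a N B); split.
- split; last exact: size_zquadratic.
  split=> //; split; first by rewrite lead_coef_zquadratic.
  rewrite zeval_cf_moebius // (_ : 1 - _ - _ = 0) ?mul0r //.
  move: z2; lra.
- by rewrite height_cf_quadratic_le andbT height_gt0 //; case: irr.
(* Compare at depth [N + l], where the denominator is at least B^l. *)
- rewrite diff0 /= -(cf_moebius_fixed a a_gt0 R B N l z) // (y0E (N + l)%N).
  apply: le_trans (cf_moebius_dist a a_gt0 R _ _ _ _ _) _; rewrite ?zge0 //.
    by rewrite yge0; case/andP: (y01 (N + l)%N).
  have /andP[lo _] := cfden_block a a_gt0 B N l aB.
  rewrite lef_pV2 ?posrE ?exprn_gt0 ?ltr0n ?cfden_gt0 //; last by lia.
  rewrite mulnC exprM -!natrX ler_nat leq_exp2r //.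
  by apply: leq_trans lo; rewrite leq_pmulr // cfden_gt0.
- rewrite evalE mulr_gt0 // mulr_gt0 ?divr_gt0 //.
  by rewrite ltr_wpDr // addr_gt0.
- rewrite evalE mulrC ler_wpM2r //.
  (* Here q + q' z <= 2 q, because z <= 1 and q' <= q. Then 2 (B + 2) <= B^2 since B >= 4. *)
  have h1 : (q + q' * z) / (q + q' * y N) <= 2.
    rewrite ler_pdivrMr //; nra.
  have h2 : y N + z + B%:R <= B%:R + 2 by case/andP: (y01 N) => _ ?; lra.
  apply: (@le_trans _ _ (2 * (B%:R + 2))); last by nra.
  apply: ler_pM => //; first by rewrite divr_ge0 // ltW.
  by rewrite !addr_ge0.
Qed.

End real_values.
End block.

(** The polynomial q X - p has absolute value y_N / (q + q' y_N) at xi, which is at most y_N and so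
    at most 1 / a_N: a large digit gives a small value. *)
Lemma linear_approximation (R : realType) (a : nat -> nat) (N : nat) (y : nat -> R) :
  (forall i, (0 < a i)%N) -> (forall i, 0 < y i) ->
  (forall i, y i = ((a i)%:R + y i.+1)^-1) ->
  exists P : {poly int}, [/\ (size P <= 2)%N, (height P <= cfden a N.+1)%N,
    0 < `|zeval P (y 0)| & `|zeval P (y 0)| <= ((a N)%:R)^-1].
Proof.
move=> a_gt0 y0 yE; have yge0 i : 0 <= y i by exact: ltW.
pose P : {poly int} := Poly [:: - (cfnum a N.+1)%:Z; (cfden a N.+1)%:Z].
have evalE : `|zeval P (y 0)|
    = y N / ((cfden a N.+1)%:R + (cfden a N)%:R * y N).
  have d0 := cf_moebius_den_gt0 a a_gt0 R N (y N) (yge0 N).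
  have q0 : (cfden a N.+1)%:R != 0 :> R by rewrite pnatr_eq0 -lt0n cfden_gt0.
  (* The convergent p / q is the Moebius map at tail 0. *)
  have -> : zeval P (y 0) = (cfden a N.+1)%:R *
      (cf_moebius a R N (y N) - cf_moebius a R N 0).
    rewrite -(cf_moebius_tail a a_gt0 R y yge0 yE N) /cf_moebius !mulr0 !addr0.
    rewrite /zeval /P /= !cons_poly_def mul0r add0r.
    rewrite !rmorphD !rmorphM /= !map_polyX !map_polyC !hornerE /=.
    by rewrite mulrBr mulrCA divff // mulr1 mulrNz.
  rewrite cf_moebiusB // subr0 mulr0 addr0 normrM normrM normrM normrX normrN1.
  rewrite expr1n mul1r normfV normr_nat !gtr0_norm ?mulr_gt0 // ?ltr0n ?cfden_gt0 //.
  by field; rewrite q0 lt0r_neq0.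
have d0 := cf_moebius_den_gt0 a a_gt0 R N (y N) (yge0 N).
exists P; split.
- exact: size_Poly.
- apply/bigmax_leqP => i _; rewrite coef_Poly.
  case: (val i) => [|[|[|k]]] //=.
  by rewrite abszN; exact: cfnum_le_cfden.
- by rewrite evalE divr_gt0.
- rewrite evalE; apply: (@le_trans _ _ (y N)).
    rewrite ler_pdivrMr // ler_peMr //.
    by apply: le_trans (cf_moebius_den_ge a R N (y N) (yge0 N)); rewrite ler1n cfden_gt0.
  by rewrite yE lef_pV2 ?posrE ?ltr0n // ?lerDl // ltr_wpDr // ltr0n.
Qed.

(** * Growth of the denominators along blocks *)

Section blocks.
Variables (b lam a : nat -> nat).
Hypothesis b_gt0 : forall n, (0 < b n)%N.
Hypothesis lam_gt0 : forall n, (0 < lam n)%N.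
Hypothesis aE : block_digits b lam a.
Let S n := (\sum_(j < n) lam j)%N.

Lemma block_startS n : S n.+1 = (S n + lam n)%N.
Proof. by rewrite /S big_ord_recr. Qed.

(** The blocks are nonempty and consecutive, so every index falls in one of them. *)
Lemma block_digits_gt0 i : (0 < a i)%N.
Proof.
suff [n [j [jn ->]]] : exists n j, (j < lam n)%N /\ i = (S n + j)%N by rewrite aE.
elim: i => [|i [n [j [jn ->]]]].
  by exists 0%N, 0%N; rewrite lam_gt0 /S big_ord0.
have [jn'|jn'] := ltnP j.+1 (lam n); first by exists n, j.+1; rewrite addnS.
exists n.+1, 0%N; rewrite lam_gt0 block_startS; split=> //; lia.
Qed.

Lemma block_start_gt0 n : (0 < S n.+1)%N.
Proof. by rewrite block_startS ltn_addl. Qed.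

Lemma block_digit0 n : a (S n) = b n.
Proof. by rewrite -(aE n 0%N (lam_gt0 n)) addn0. Qed.

Lemma cfden_block_start n :
  (b n ^ lam n * cfden a (S n).+1 <= cfden a (S n.+1).+1
     <= (b n).+1 ^ lam n * cfden a (S n).+1)%N.
Proof. rewrite block_startS; apply: cfden_block block_digits_gt0 _ _ _ (aE n). Qed.

Lemma leq_cfden_block n : (b n <= cfden a (S n.+1).+1)%N.
Proof.
have /andP[lo _] := cfden_block_start n; apply: leq_trans lo.
rewrite -[leqLHS]expn1 -[leqLHS]muln1 leq_mul ?cfden_gt0 //.
  by rewrite leq_pexp2l.
exact: block_digits_gt0.
Qed.

Let W n := (\prod_(k < n) b k ^ lam k)%N.

Lemma block_prod_gt0 n : (0 < W n)%N.
Proof. by rewrite prodn_gt0 // => i; rewrite expn_gt0 b_gt0. Qed.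

(** Once b_n >= 2, the factor (b_n + 1)^lam_n of a block is at most the square of b_n^lam_n; the
    finitely many earlier digits are absorbed in the exponent. *)
Lemma cfden_le_block_prod n0 : (forall n, (n0 <= n)%N -> (2 <= b n)%N) ->
  exists C, forall n, (n0 < n)%N -> (cfden a (S n).+1 <= W n ^ C)%N.
Proof.
(* With q the denominator after block [n0], the exponent q + 2 serves twice: q < 2^(q + 2) starts
   the induction, and an exponent of at least 2 gives b + 1 <= b^2 in the step. *)
move=> b2; exists (cfden a (S n0.+1).+1).+2.
elim=> // n IH; rewrite ltnS leq_eqVlt => /orP[/eqP <-|n0n].
  have W2 : (2 <= W n0.+1)%N.
    rewrite /W big_ord_recr /= -[2%N]mul1n leq_mul ?block_prod_gt0 //.
    apply: leq_trans (b2 n0 (leqnn _)) _.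
    by rewrite -[leqLHS]expn1 leq_pexp2l.
  apply: (@leq_trans (2 ^ (cfden a (S n0.+1).+1).+2)%N); last by rewrite leq_exp2r.
  by apply: ltnW; apply: leq_trans (ltn_expl _ _) => //; exact/ltnW/ltnW.
have /andP[_ up] := cfden_block_start n; apply: leq_trans up _.
rewrite /W big_ord_recr /= expnMn mulnC leq_mul ?IH //.
rewrite -!expnM mulnC expnM leq_exp2r ?lam_gt0 //.
have b2n := b2 n (ltnW n0n).
apply: (@leq_trans (b n ^ 2)%N); first by rewrite expnS expn1; nia.
by rewrite leq_pexp2l.
Qed.

Variable R : realType.
Hypothesis b_cvg : (fun n => ((b n)%:R : R)) @ \oo --> +oo.
Hypothesis ratio_cvg : (fun n => ln ((b n.+1)%:R : R) /
  \sum_(k < n.+1) ((lam k)%:R * ln ((b k)%:R : R))) @ \oo --> +oo.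

Lemma natr_cvgy_ge (u : nat -> nat) (m : nat) :
  (fun n => ((u n)%:R : R)) @ \oo --> +oo -> \forall n \near \oo, (m <= u n)%N.
Proof.
move=> /cvgryPge /(_ m%:R); apply: filterS => n; by rewrite ler_nat.
Qed.

Lemma ln_block_prod n :
  \sum_(k < n) ((lam k)%:R * ln ((b k)%:R : R)) = ln ((W n)%:R).
Proof.
rewrite /W; elim: n => [|n IH]; first by rewrite !big_ord0 ln1.
have b0 : 0 < (b n)%:R :> R by rewrite ltr0n.
rewrite !big_ord_recr /= IH natrM lnM ?posrE ?ltr0n ?block_prod_gt0 //.
  by rewrite natrX lnXn // mulr_natl.
by rewrite expn_gt0 b_gt0.
Qed.

Lemma cfden_growth K :
  \forall n \near \oo, (cfden a (S n.+1).+1 ^ K <= b n.+1)%N.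
Proof.
have [n0 _ b2] := natr_cvgy_ge b 2 b_cvg.
have [C qW] := cfden_le_block_prod n0 b2.
(* The threshold C K yields W^(C K) <= b_(n+1), while q^K <= W^(C K). *)
move/cvgryPge: ratio_cvg => /(_ (C * K)%:R) near_ratio.
apply: filterS2 (nbhs_infty_ge n0) near_ratio => n n0n ratio.
apply: (@leq_trans (W n.+1 ^ (C * K))%N).
  by rewrite expnM; case: K {ratio} => // K; rewrite leq_exp2r ?qW.
(* This makes ln W positive, so that the quotient can be cleared. *)
have W2 : (2 <= W n.+1)%N.
  rewrite /W big_ord_recr /= -[2%N]mul1n leq_mul ?block_prod_gt0 //.
  apply: leq_trans (b2 n n0n) _.
  by rewrite -[leqLHS]expn1 leq_pexp2l.
have Wp : 0 < (W n.+1)%:R :> R by rewrite ltr0n block_prod_gt0.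
move: ratio; rewrite ln_block_prod ler_pdivlMr ?ln_gt0 ?ltr1n //.
rewrite mulr_natl -lnXn // ler_ln ?posrE ?exprn_gt0 ?ltr0n ?block_prod_gt0 //.
by rewrite -natrX ler_nat.
Qed.

End blocks.

(** * Choice of blocks and of the bound H for the three exponents *)

Theorem theorem1p2 (R : realType) (b lam : nat -> nat) (a : nat -> nat) (xi : R) :
  (forall n, (0 < b n)%N) -> (forall n, (0 < lam n)%N) ->
  block_digits b lam a -> cf_value a xi ->
  (fun n => ((b n)%:R : R)) @ \oo --> +oo ->
  (fun n => ((lam n)%:R : R)) @ \oo --> +oo ->
  (fun n => ln ((b n.+1)%:R : R) /
              \sum_(k < n.+1) ((lam k)%:R * ln ((b k)%:R : R))) @ \oo --> +oo ->
  Liouville xi /\ weq_infinite 2 xi /\ weqstar_infinite 2 xi.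
Proof.
move=> b_gt0 lam_gt0 aE cv b_cvg lam_cvg ratio_cvg.
have a_gt0 := block_digits_gt0 b lam a b_gt0 lam_gt0 aE.
have [y [<- y01 yE]] := cf_tails R a xi a_gt0 cv.
have ygt0 i : 0 < y i by case/andP: (y01 i).
have growth := cfden_growth b lam a b_gt0 lam_gt0 aE R b_cvg ratio_cvg.
have upper (M : R) : M <= (Num.bound M)%:R by exact/ltW/unstable.ltr_bound.
have powRnat (H : R) k : 0 <= H -> H `^ (- k%:R) = (H ^+ k)^-1.
  by move=> H0; rewrite powRN powR_mulrn.
split.
  move=> M; set k := Num.bound M; exists k%:R; split=> [|H0]; first exact: upper.
  have [n [qk bn]] : exists n,
      (cfden a (\sum_(j < n.+1) lam j).+1 ^ k <= b n.+1)%N /\ (Num.bound H0 <= b n)%N.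
    apply: (@filter_ex _ \oo).
    by apply: filterI; [exact: growth | exact: (natr_cvgy_ge _ _ _ b_cvg)].
  have [P [sP hP eP0 eP]] :=
    linear_approximation R a (\sum_(j < n.+1) lam j) y a_gt0 ygt0 yE.
  (* H is the denominator q before block n + 1: it is at least b_n, hence arbitrarily large, and q^k
     is at most the next digit. *)
  exists (cfden a (\sum_(j < n.+1) lam j).+1)%:R; split.
    apply: le_trans (upper H0) _; rewrite ler_nat (leq_trans bn) //.
    exact: leq_cfden_block.
  exists P; split=> //; split; first by rewrite ler_nat.
  split=> //; apply: le_trans eP _.
  rewrite (block_digit0 b lam a) // powRnat //.
  rewrite lef_pV2 ?posrE ?exprn_gt0 ?ltr0n ?cfden_gt0 //.
  by rewrite -natrX ler_nat.
(* One block serves both quadratic exponents. Working with block n + 1 keeps its start [N]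
   positive. *)
have quad (k : nat) (H0 : R) : exists (H : R), H0 <= H /\
    exists (alpha : R) (P : {poly int}),
    [/\ zminpoly alpha P /\ size P = 3%N, (height P)%:R <= H,
       0 < `|y 0 - alpha| /\ `|y 0 - alpha| <= ((height P)%:R)^-1 * (H ^+ k)^-1,
       0 < `|zeval P (y 0)| & `|zeval P (y 0)| <= (H ^+ k)^-1].
  have [n [[q2 q2'] [[bn b4] lamn]]] : exists n,
      ((cfden a (\sum_(j < n.+1) lam j).+1 ^ 2 <= b n.+1)%N /\
       (cfden a (\sum_(j < n.+2) lam j).+1 ^ 2 <= b n.+2)%N) /\
      ((Num.bound H0 <= b n.+1)%N /\ (4 <= b n.+1)%N) /\ (3 * k + 3 <= lam n.+1)%N.
    have sh (Q : nat -> Prop) : (\forall n \near \oo, Q n) -> \forall n \near \oo, Q n.+1.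
      by move=> [m _ Qm]; exists m => // i /= mi; apply: Qm; exact: leqW.
    apply: (@filter_ex _ \oo); apply: filterI; first apply: filterI.
    - exact: growth.
    - exact: (sh _ (growth 2%N)).
    - apply: filterI; last exact: (sh _ (natr_cvgy_ge _ _ _ lam_cvg)).
      by apply: filterI; exact: (sh _ (natr_cvgy_ge _ _ _ b_cvg)).
  set N := (\sum_(j < n.+1) lam j)%N in q2; set B := b n.+1 in q2 bn b4.
  have N0 : (0 < N)%N by exact: block_start_gt0.
  have SE : (\sum_(j < n.+2) lam j = N + lam n.+1)%N by rewrite big_ord_recr.
  (* The denominator after the block is at least B >= 4, and its square is at most the next
     digit. *)
  have BB : (B < a (N + lam n.+1)%N)%N.
    rewrite -SE (block_digit0 b lam a) //; apply: leq_trans q2'.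
    have := leq_cfden_block b lam a b_gt0 lam_gt0 aE n.+1; rewrite -/B; nia.
  have [alpha [P [mP /andP[h0 hP] /andP[d0 d] e0 e]]] :=
    quadratic_approximation a a_gt0 N B N0 b4 q2 R y (lam n.+1) y01 yE (aE n.+1) BB.
  have B4 : (4 : R) <= B%:R by rewrite ler_nat.
  have B0 : (0 < B)%N by lia.
  have Bgt0 : (0 : R) < B%:R by rewrite ltr0n.
  have dk : `|y 0 - alpha| <= (B%:R ^+ (3 * k + 3))^-1.
    apply: le_trans d _; rewrite lef_pV2 ?posrE ?exprn_gt0 //.
    by rewrite ler_weXn2l //; [lra | lia].
  (* H = B^3 bounds the height. Of the exponent 3 k + 3 in [dk], the part 3 k gives H^(-k); the
     spare B^(-3) pays for the height of P in one estimate and for the factor B^2 in the other. *)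
  exists (B%:R ^+ 3); split.
    apply: le_trans (upper H0) _; rewrite -natrX ler_nat; apply: leq_trans bn _.
    by rewrite -[leqLHS]expn1 leq_pexp2l //; lia.
  exists alpha, P; split=> //.
  - by rewrite -natrX ler_nat.
  - split=> //; apply: le_trans dk _; rewrite -exprM -invfM.
    rewrite lef_pV2 ?posrE ?mulr_gt0 ?exprn_gt0 ?ltr0n //.
    rewrite addnC exprD; apply: ler_wpM2r; first by rewrite exprn_ge0 ?ltW.
    by rewrite -natrX ler_nat.
  - apply: le_trans e _; apply: le_trans (ler_wpM2l _ dk) _; first exact: sqr_ge0.
    rewrite -exprM ler_pdivrMr ?exprn_gt0 // exprD mulKf ?lt0r_neq0 ?exprn_gt0 //.
    by rewrite ler_weXn2l //; lra.
split=> M; set k := Num.bound M; exists k%:R; (split=> [|H0]; first exact: upper);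
  have [H [HH [alpha [P [[mP sP] hP [d0 d] e0 e]]]]] := quad k H0;
  exists H; split=> //; have Hge0 : 0 <= H by apply: le_trans hP.
  by exists P; rewrite powRnat //; case: mP.
by exists alpha, P; rewrite powRnat.
Qed.
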